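(* Let $C$ be an algebraically closed field of characteristic $0$. Let $A=C[x_1,\dots,x_n]$ be an integral domain finitely generated as a $C$-algebra by elements $x_1,\dots,x_n$ (not necessarily algebraically independent), equipped with a derivation $D$, of transcendence degree one over $C$ (equivalently, of Krull dimension one), such that $C$ is the field of differential constants of the quotient field $E$ of $A$. Then $A$ has a finitely generated extension $T$ with $A\subseteq T\subseteq E$ such that $T$ has no nonzero proper differential ideals.
   Context: The derivation $D$ of $A$ is extended to the quotient field $E$ by the quotient rule; the field of differential constants of $E$ is $\{w\in E: D(w)=0\}$. A differential ideal is an ideal $I$ with $D(I)\subseteq I$. A finitely generated extension of $A$ within $E$ means a subring $T$ of $E$ containing $A$, finitely generated as an $A$-algebra and closed under $D$. *)

(* Defs.v *)
From HB Require Import structures.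
From mathcomp Require Import all_boot all_order all_algebra.
From mathcomp Require Import boolp classical_sets.
From mathcomp Require Import mpoly.
From mathcomp Require Import ring.

Set Implicit Arguments.
Unset Strict Implicit.
Unset Printing Implicit Defensive.

Import GRing.Theory.

Local Open Scope ring_scope.
Local Open Scope quotient_scope.
Local Open Scope classical_set_scope.

Notation "x %:F" := (FracField.tofrac x) : ring_scope.

Definition derivation (R : comNzRingType) (D : R -> R) : Prop :=
  zmod_morphism D /\ forall a b, D (a * b) = D a * b + a * D b.

(* The quotient rule applied to a chosen numerator and denominator; [fracDE]
   shows that the value does not depend on the choice. *)
Definition fracD (A : idomainType) (D : A -> A) (w : {fraction A}) :
    {fraction A} :=
  let r := repr w in
  (D \n_r * \d_r - \n_r * D \d_r)%:F / (\d_r ^+ 2)%:F.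

Lemma fracDE (A : idomainType) (D : A -> A) (a b : A) :
  derivation D -> b != 0 ->
  fracD D (a%:F / b%:F) = (D a * b - a * D b)%:F / (b ^+ 2)%:F.
Proof.
move=> [_ Dmul] b0; rewrite /fracD; set r := repr _.
have d0 : \d_r != 0 by exact: denom_ratioP.
have nE (q : {ratio A}) : (\n_q)%:F = \pi_({fraction A}) q * (\d_q)%:F.
  unlock FracField.tofrac; rewrite -[RHS]FracField.pi_mul; apply/eqmodP.
  have q0 : \d_q != 0 by exact: denom_ratioP.
  rewrite /= FracField.equivfE /FracField.mulf !numden_Ratio ?mulr1 ?oner_eq0 //.
  by rewrite mul1r mulrC.
have F0 (c : A) : c != 0 -> c%:F != 0 by rewrite tofrac_eq0.
have E : \n_r * b = a * \d_r.
  apply/eqP; rewrite -tofrac_eq !tofracM nE reprK.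
  by rewrite mulrAC -(mulrA _ _ b%:F) mulVf ?F0 // mulr1.
have DE : D \n_r * b + \n_r * D b = D a * \d_r + a * D \d_r.
  by rewrite -!Dmul E.
apply/eqP; rewrite eqr_div ?F0 ?expf_neq0 // -!tofracM tofrac_eq; apply/eqP.
have -> : (D \n_r * \d_r - \n_r * D \d_r) * b ^+ 2 =
          (D \n_r * b) * (\d_r * b) - (\n_r * b) * (D \d_r * b) by ring.
have -> : D \n_r * b = D a * \d_r + a * D \d_r - \n_r * D b by rewrite -DE addrK.
transitivity ((D a * \d_r + a * D \d_r) * (\d_r * b)
              - (\n_r * b) * (\d_r * D b + D \d_r * b)); first by ring.
by rewrite E; ring.
Qed.

Lemma fracD_tofrac (A : idomainType) (D : A -> A) (a : A) :
  derivation D -> fracD D a%:F = (D a)%:F.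
Proof.
move=> dD; have [_ Dmul] := dD.
have D1 : D 1 = 0.
  by apply: (@addrI _ (D 1)); rewrite -[in RHS](mulr1 1) Dmul !mulr1 mul1r addr0.
have := fracDE a dD (oner_neq0 A).
by rewrite D1 mulr0 subr0 expr1n tofrac1 !divr1 mulr1.
Qed.

Definition constants (R : nmodType) (D : R -> R) : set R := [set w | D w = 0].

(* The subring f(R)[v_0, ..., v_(n-1)] of S. *)
Definition adjoin (R S : comNzRingType) (f : R -> S) (n : nat)
    (v : 'I_n -> S) : set S :=
  range (fun p : {mpoly R[n]} => mmap f v p).

Definition alg_independent (R S : comNzRingType) (f : R -> S) (n : nat)
    (v : 'I_n -> S) : Prop :=
  forall p : {mpoly R[n]}, mmap f v p = 0 -> p = 0.

(* d is the largest size of an algebraically independent family; larger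
   families are excluded with those of size d.+1, since subfamilies of
   independent families are independent. *)
Definition has_trdeg (R S : comNzRingType) (f : R -> S) (d : nat) : Prop :=
  (exists v : 'I_d -> S, alg_independent f v) /\
  (forall v : 'I_d.+1 -> S, ~ alg_independent f v).

Definition fg_extension (A : idomainType) (D : A -> A)
    (T : set {fraction A}) : Prop :=
  [/\ subring_closed (mem T),
      forall a : A, T a%:F,
      exists m (y : 'I_m -> {fraction A}), T = adjoin (@FracField.tofrac A) y
    & forall u, T u -> T (fracD D u)].

Definition ideal_of (R : comNzRingType) (T I : set R) : Prop :=
  [/\ I `<=` T, I 0,
      forall u v, I u -> I v -> I (u + v)
    & forall t u, T t -> I u -> I (t * u)].

Definition differential_ideal (R : comNzRingType) (D : R -> R) (T I : set R) :
    Prop :=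
  ideal_of T I /\ forall u, I u -> I (D u).

(* Main.v *)
Require Import Defs.
From HB Require Import structures.
From mathcomp Require Import all_boot all_order all_algebra.
From mathcomp Require Import boolp classical_sets.
From mathcomp Require Import mpoly.
From mathcomp Require Import ring.

Set Implicit Arguments.
Unset Strict Implicit.
Unset Printing Implicit Defensive.

Import GRing.Theory.

Local Open Scope ring_scope.
Local Open Scope classical_set_scope.

(** Why the theorem is true. Transcendence degree one leaves room for an
    element y of A that is transcendental over the constants, so D y <> 0, and
    T = A[1 / D y] does the job. It is closed under D by the quotient rule
    ([fg_extension_inv]).

    Let I be a nonzero differential ideal of T. Clearing denominators gives a
    nonzero a in A belonging to I. As y and a are algebraically dependent,
    there is a nonzero polynomial relation P(y, a) = 0; divide it by the
    largest possible power of a, and its part of degree 0 in a becomes a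
    nonzero polynomial p in y alone with p(y) a multiple of a
    ([nonzero_root_divides_coef]). Hence p(y) is in I. Now
    D (p(y)) = p'(y) D y, and D y is a unit of T, so p'(y) is in I as well.
    In characteristic 0 repeated differentiation turns p into a nonzero
    constant, so I contains a unit
    ([saturated_differential_ideal_one]). This last descent takes place in A,
    on the contraction of I, where invertibility of D y in T shows up as
    saturation with respect to D y. *)

(** If a root a of P is nonzero, powers of the variable can be cancelled from P;
    once its constant term p is nonzero, the equation P(a) = 0 displays f p as
    a multiple of a. *)
Lemma nonzero_root_divides_coef (B A : idomainType) (f : {rmorphism B -> A})
    (P : {poly B}) (a : A) :
  P != 0 -> a != 0 -> (map_poly f P).[a] = 0 ->
  exists (p : B) (b : A), p != 0 /\ f p = b * a.
Proof.
move=> P0 a0; elim/poly_ind: P P0 => [|P c IH]; first by rewrite eqxx.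
rewrite rmorphD rmorphM /= map_polyX map_polyC /= hornerMXaddC.
have [-> | c0] := eqVneq c 0.
  rewrite polyC0 addr0 rmorph0 addr0 mulf_eq0 polyX_eq0 orbF => P0 /eqP.
  by rewrite mulf_eq0 (negPf a0) orbF => /eqP /(IH P0).
move=> _ Pa0; exists c, (- (map_poly f P).[a]); split=> //.
by rewrite mulNr; apply/eqP; rewrite -addr_eq0 addrC Pa0.
Qed.

Lemma mmap1_2 (S : comNzRingType) (h : 'I_2 -> S) (m : 'X_{1..2}) :
  mmap1 h m = h ord0 ^+ m ord0 * h ord_max ^+ m ord_max.
Proof.
rewrite /mmap1 big_ord_recl big_ord1.
by have -> : lift ord0 ord0 = ord_max :> 'I_2 by apply/val_inj.
Qed.

(** A relation between two elements, read as a polynomial in the second with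
    coefficients polynomial in the first: in this form its lowest coefficient
    can be isolated by cancelling powers of one variable. *)
Lemma alg_dependent2_poly (C A : comNzRingType) (iota : {rmorphism C -> A})
    (v : 'I_2 -> A) (cv : commr_rmorph iota (v ord0)) :
  ~ alg_independent iota v ->
  exists2 P : {poly {poly C}}, P != 0 &
    (map_poly (horner_morph cv) P).[v ord_max] = 0.
Proof.
move=> /existsNP[q /not_implyP[qv0 /eqP q0]].
pose CX : C -> {poly {poly C}} := polyC \o polyC.
pose h (i : 'I_2) : {poly {poly C}} := if i == ord0 then 'X%:P else 'X.
have biv_mono c m p : mmap CX h (c *: 'X_[m] + p) =
    ('X^(m ord_max) * ((c *: 'X^(m ord0))%:P : {poly {poly C}})) + mmap CX h p.
  rewrite mmapD mmapZ mmapX mmap1_2 /h /= -mul_polyC polyCM rmorphXn /=.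
  by congr (_ + _); ring.
(* No cancellation: the coefficients of the translated polynomial are those
   of q, so it is nonzero with q. *)
exists (mmap CX h q).
  apply: contra_neq q0 => biv0; apply/mpolyP => m.
  have <- : (mmap CX h q)`_(m ord_max)`_(m ord0) = q@_m.
    elim/mpolyind: (q) => [|c m' p _ _ IH].
      by rewrite mmap0 !coef0 mcoeff0.
    rewrite biv_mono !coefD IH mcoeffD mcoeffZ mcoeffX coefMC coefXn.
    congr (_ + _); rewrite [m' == m](_ : _ =
      (m ord_max == m' ord_max) && (m ord0 == m' ord0)); last first.
      apply/eqP/andP => [->//|[/eqP e1 /eqP e0]]; apply/mnmP => i.
      have [->|->] : i = ord0 \/ i = ord_max by
        case: i => -[|[|//]] ?; [left|right]; apply/val_inj.
      - by rewrite e0.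
      - by rewrite e1.
    case: eqP => _; last by rewrite mul0r coef0 mulr0.
    by rewrite mul1r coefZ coefXn.
  by rewrite biv0 !coef0 mcoeff0.
rewrite -[RHS]qv0; elim/mpolyind: (q) => [|c m p _ _ IH].
  by rewrite !mmap0 rmorph0 horner0.
rewrite biv_mono mmapD mmapZ mmapX mmap1_2 !rmorphD !rmorphM /=.
rewrite map_polyXn map_polyC /= !hornerE IH -mul_polyC rmorphM rmorphXn /=.
rewrite horner_morphC horner_morphX.
by congr (_ + _); ring.
Qed.

Lemma derivation_horner (C A : comNzRingType) (iota : {rmorphism C -> A})
    (D : A -> A) (y : A) (p : {poly C}) :
  derivation D -> (forall c, D (iota c) = 0) ->
  D (map_poly iota p).[y] = D y * (map_poly iota p^`()).[y].
Proof.
move=> [DB DM] Dc.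
have D0 : D 0 = 0 by rewrite -[X in D X](subrr 0) DB subrr.
have DD a b : D (a + b) = D a + D b.
  by rewrite -[b in LHS]opprK DB -[- b]sub0r DB D0 sub0r opprK.
elim/poly_ind: p => [|p c IH].
  by rewrite deriv0 rmorph0 !horner0 D0 mulr0.
rewrite derivD derivM derivX derivC addr0 mulr1 !rmorphD !rmorphM /=.
rewrite map_polyX map_polyC !hornerE DD DM Dc IH /=.
by ring.
Qed.

(** Differentiating p(y) and cancelling D y replaces p by its derivative, of
    smaller degree; the process can only end at a nonzero constant, which is a
    unit of the ground field. Saturation is what a differential ideal of
    A[1 / D y] retains when it is contracted to A. *)
Lemma saturated_differential_ideal_one (C : fieldType) (A : comNzRingType)
    (iota : {rmorphism C -> A}) (D : A -> A) (J : set A) (y : A)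
    (p : {poly C}) :
  [pchar C] =i pred0 -> derivation D -> (forall c, D (iota c) = 0) ->
  differential_ideal D [set: A] J -> (forall a, J (D y * a) -> J a) ->
  p != 0 -> J (map_poly iota p).[y] -> J 1.
Proof.
move=> charC derD Dc [[_ _ _ JM] JD] Jsat.
elim: {p}(size p) {-2}p (leqnn (size p)) => [|k IH] p.
  by rewrite leqn0 size_poly_eq0 => /eqP->; rewrite eqxx.
move=> szp p0 Jp.
(* While p' is nonzero, D (p(y)) = D y * p'(y) and saturation bring the
   problem down to p'; in characteristic 0, p' = 0 forces p to be constant. *)
have [dp0|dp0] := eqVneq p^`() 0; last first.
  apply: (IH p^`()) => //.
    by rewrite -ltnS (leq_trans (lt_size_deriv p0)).
  by apply: Jsat; rewrite -derivation_horner //; apply: JD.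
have pC : p = (p`_0)%:P.
  apply/polyP => -[|i]; rewrite coefC //=.
  have := congr1 (fun q : {poly C} => q`_i) dp0.
  rewrite /= coef_deriv coef0 -mulr_natr => /eqP.
  by rewrite mulf_eq0 (pcharf0P _).1 // orbF => /eqP.
move: p0 Jp; rewrite pC polyC_eq0 map_polyC hornerC /= => c0 Jc.
by have := JM (iota (p`_0)^-1) _ I Jc; rewrite -rmorphM mulVf // rmorph1.
Qed.

Lemma adjoin_invE (A : idomainType) (s : A) (u : {fraction A}) :
  s != 0 ->
  adjoin (@FracField.tofrac A) (fun _ : 'I_1 => s%:F^-1) u <->
  exists (a : A) (k : nat), u = a%:F / (s ^+ k)%:F.
Proof.
move=> s0; have sF0 k : (s ^+ k)%:F != 0 by rewrite tofrac_eq0 expf_neq0.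
split=> [[q _ <-]|[a [k ->]]].
  elim/mpolyind: q => [|c m p _ _ [a [k IH]]].
    by exists 0, 0%N; rewrite mmap0 tofrac0 mul0r.
  exists (c * s ^+ k + a * s ^+ m ord0), (m ord0 + k)%N.
  rewrite mmapD mmapZ mmapX IH /mmap1 big_ord1 exprVn -tofracXn.
  by rewrite addf_div // exprD tofracD !tofracM.
exists (a%:MP * 'X_ord0 ^+ k) => //.
by rewrite rmorphM rmorphXn /= mmapC mmapX mmap1U exprVn -tofracXn.
Qed.

Lemma subring_closed_adjoin (R S : comNzRingType) (f : {rmorphism R -> S})
    (n : nat) (v : 'I_n -> S) :
  subring_closed (mem (adjoin f v)).
Proof.
split=> [|a b|a b]; rewrite !inE.
- by exists 1 => //; rewrite rmorph1.
- by move=> [p _ <-] [q _ <-]; exists (p - q) => //; rewrite rmorphB.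
- by move=> [p _ <-] [q _ <-]; exists (p * q) => //; rewrite rmorphM.
Qed.

(** Inverting one element is enough to keep both finite generation and
    stability: the quotient rule only squares the denominator s ^+ k. *)
Lemma fg_extension_inv (A : idomainType) (D : A -> A) (s : A) :
  derivation D -> s != 0 ->
  fg_extension D (adjoin (@FracField.tofrac A) (fun _ : 'I_1 => s%:F^-1)).
Proof.
move=> derD s0; split.
- exact: subring_closed_adjoin.
- by move=> a; exists a%:MP => //; rewrite mmapC.
- by exists 1%N, (fun _ => s%:F^-1).
- move=> u /adjoin_invE => /(_ s0) [a [k ->]]; apply/adjoin_invE => //.
  by rewrite fracDE ?expf_neq0 // -exprM; do 2 eexists.
Qed.

(** An element of A killed by D is a constant of the quotient field, hence in
    the image of the ground ring, whereas a member of an algebraically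
    independent family is not. *)
Lemma exists_nonconstant (C : comNzRingType) (A : idomainType)
    (iota : {rmorphism C -> A}) (D : A -> A) (d : nat) :
  derivation D -> has_trdeg iota d.+1 ->
  constants (fracD D) `<=` range (fun c : C => (iota c)%:F) ->
  exists y : A, D y != 0.
Proof.
move=> derD [[v vfree] _] constE; exists (v ord0); apply/eqP => Dv0.
have [c _ /eqP] : range (fun c : C => (iota c)%:F) (v ord0)%:F.
  by apply: constE; rewrite /constants /= fracD_tofrac // Dv0 tofrac0.
rewrite tofrac_eq => /eqP vc.
have /vfree /eqP : mmap iota v ('X_ord0 - c%:MP) = 0.
  by rewrite mmapB mmapX mmapC mmap1U /= vc subrr.
rewrite subr_eq0 => /eqP /(congr1 (mcoeff U_(ord0)%MM)) /eqP.
by rewrite mcoeffX eqxx mcoeffC mnm1_eq0 mulr0 oner_eq0.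
Qed.

Theorem theorem4 (C : closedFieldType) (A : idomainType)
    (iota : {rmorphism C -> A}) (n : nat) (x : 'I_n -> A) (D : A -> A)
    (charC : [pchar C] =i pred0)
    (genA : adjoin iota x = [set: A])
    (derD : derivation D)
    (trdegA : has_trdeg iota 1)
    (constE : constants (fracD D) = range (fun c : C => (iota c)%:F)) :
  exists T : set {fraction A},
    fg_extension D T /\
    ~ (exists I : set {fraction A},
         [/\ differential_ideal (fracD D) T I, I <> [set 0] & I <> T]).
Proof.
have [y Dy0] : exists y : A, D y != 0.
  by apply: (exists_nonconstant derD trdegA); rewrite constE.
have Dc c : D (iota c) = 0.
  have : constants (fracD D) (iota c)%:F by rewrite constE; exists c.
  by rewrite /constants /= fracD_tofrac // => /eqP; rewrite tofrac_eq0 => /eqP.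
set T := adjoin (@FracField.tofrac A) (fun _ : 'I_1 => (D y)%:F^-1).
have TE u : T u <-> exists (a : A) (k : nat), u = a%:F / (D y ^+ k)%:F.
  exact: adjoin_invE.
have TA a : T a%:F by exists a%:MP => //; rewrite mmapC.
exists T; split; first exact: fg_extension_inv.
move=> [I [[[IT I0 ID IM] IDer] In0 InT]].
pose J : set A := [set a | I a%:F].
have J1 : ~ J 1.
  move=> /= I1; apply: InT; apply/seteqP; split=> // t Tt.
  by rewrite -[t]mulr1 -tofrac1; apply: IM.
(* The numerator of any nonzero element of I again lies in I. *)
have [a Ja a0] : exists2 a, J a & a != 0.
  apply: contrapT => Jn; apply: In0; apply/seteqP; split=> [u Iu|u ->//].
  apply: contrapT => u0; apply: Jn.
  have [a [k ua]] := (TE u).1 (IT u Iu); exists a.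
    rewrite /J /=; have -> : a%:F = (D y ^+ k)%:F * u; last exact: IM.
    by rewrite ua mulrC divfK // tofrac_eq0 expf_neq0.
  by apply/eqP => a0; apply: u0; rewrite ua a0 tofrac0 mul0r.
have Jdiff : differential_ideal D [set: A] J.
  split=> [|b Jb]; last by rewrite /J /= -fracD_tofrac //; apply: IDer.
  split; first exact: subsetT.
  - by rewrite /J /= tofrac0.
  - by move=> b c Jb Jc; rewrite /J /= tofracD; apply: ID.
  - by move=> b c _ Jc; rewrite /J /= tofracM; apply: IM.
have Jsat b : J (D y * b) -> J b.
  move=> Jb; rewrite /J /=.
  have -> : b%:F = (D y)%:F^-1 * (D y * b)%:F.
    by rewrite tofracM mulKf // tofrac_eq0.
  by apply: IM => //; apply/TE; exists 1, 1%N; rewrite tofrac1 mul1r expr1.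
pose v (i : 'I_2) := if i == ord0 then y else a.
have cv : commr_rmorph iota (v ord0) by move=> c; apply: mulrC.
have [P P0 Pa0] := alg_dependent2_poly cv (trdegA.2 v).
have [p [b [p0 pE]]] := nonzero_root_divides_coef P0 a0 Pa0.
apply: J1.
apply: (saturated_differential_ideal_one charC derD Dc Jdiff Jsat p0).
rewrite [X in J X]pE; case: Jdiff => -[_ _ _ JM] _; exact: JM.
Qed.
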